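(* Let $G$ be a totally disconnected, locally compact group of type (JH), with $\mathrm{QZ}(G)=\{1\}$. Then there is a hereditarily just infinite profinite group $J$ and an open subgroup $$P = P_1 \times P_2 \times \dots \times P_n$$ of $G$, where the factors $P_1,\dots,P_n$ have the following properties: (i) Every automorphism of $G$ permutes the factors $\{P_1,\dots,P_n\}$ (possibly trivially); in particular, $P$ is characteristic in $G$. (ii) For $1 \le i \le n$, $\mathrm{QZ}(P_i) = \{1\}$ and $P_i$ has a compact open subgroup isomorphic to $J$. (iii) Given $1 \le i \le n$, exactly one of the following holds: (Reducible type) $P_i \cap \mathrm{Res}(G) = \{1\}$; (Mysterious type) $P_i \cap \mathrm{Res}(G)$ is open in $P_i$, but $P_i \cap \mathrm{Res}(\mathrm{Res}(G)) = \{1\}$; (Simple type) $P_i \cap \mathrm{Res}(G) = \mathrm{Res}(P_i)$ is open in $P_i$ and topologically simple.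
   Context: All groups are locally compact Hausdorff topological groups. Direct products carry the product topology; direct factors are closed subgroups. Automorphisms are topological group automorphisms. The quasi-centre $\mathrm{QZ}(G)$ is the set of elements of $G$ with open centralizer. $\mathrm{Res}(G)$ is the intersection of all open normal subgroups of $G$. A subgroup of $G$ is locally normal if its normalizer is open in $G$. Two subgroups $H,K$ are locally equivalent if $H\cap K$ is open in both; $[H]$ denotes the local equivalence class. The structure lattice $\mathcal{LN}(G)$ is the set of classes $[H]$ of closed locally normal subgroups $H$ of $G$, ordered by inclusion of representatives. A profinite group is just infinite if it is infinite and every nontrivial closed normal subgroup has finite index; it is hereditarily just infinite if every open subgroup is just infinite. Type (JH): a nondiscrete totally disconnected locally compact group $G$ is of type (JH) if $\mathrm{QZ}(G)$ is discrete, $\mathcal{LN}(G)$ is finite and an open subgroup of $G$ is a direct product of $n$ copies of a hereditarily just infinite profinite group, where $2^n=|\mathcal{LN}(G)|$. *)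

(* Defs.v *)
From HB Require Import structures.
From mathcomp Require Import all_boot perm.
From mathcomp Require Import all_classical topology.

Set Implicit Arguments.
Unset Strict Implicit.
Unset Printing Implicit Defensive.

Local Open Scope classical_set_scope.
Local Open Scope card_scope.
Local Open Scope group_scope.

HB.mixin Record Group_isTopologicalGroup G of Group G & Topological G := {
  mulg_continuous : continuous (fun xy : G * G => xy.1 * xy.2) ;
  invg_continuous : continuous (fun x : G => x^-1)
}.

#[short(type="topGroupType")]
HB.structure Definition TopologicalGroup :=
  {G of Group G & Topological G & Group_isTopologicalGroup G}.

Lemma cvgMg (T : Type) (F : set_system T) (FF : Filter F) (G : topGroupType)
    (f g : T -> G) (a b : G) :
  f @ F --> a -> g @ F --> b -> (fun x => f x * g x) @ F --> a * b.
Proof.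
move=> fa gb.
exact: (cvg_comp _ _ (cvg_pair fa gb) (@mulg_continuous G (a, b))).
Qed.

Lemma cvgVg (T : Type) (F : set_system T) (FF : Filter F) (G : topGroupType)
    (f : T -> G) (a : G) :
  f @ F --> a -> (fun x => (f x)^-1) @ F --> a^-1.
Proof. by move=> fa; exact: (cvg_comp _ _ fa (@invg_continuous G a)). Qed.

Section ProductGroup.
Variables (I : eqType) (T : I -> topGroupType).
Implicit Types f g h : prod_topology T.

Definition dprod_mul f g : prod_topology T := fun i => f i * g i.
Definition dprod_one : prod_topology T := fun=> 1.
Definition dprod_inv f : prod_topology T := fun i => (f i)^-1.

Let dprod_mulA : associative dprod_mul.
Proof. by move=> f g h; apply: functional_extensionality_dep => i; exact: mulgA. Qed.
Let dprod_mul1 : left_id dprod_one dprod_mul.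
Proof. by move=> f; apply: functional_extensionality_dep => i; exact: mul1g. Qed.
Let dprod_mulr1 : right_id dprod_one dprod_mul.
Proof. by move=> f; apply: functional_extensionality_dep => i; exact: mulg1. Qed.
Let dprod_mulV : left_inverse dprod_one dprod_inv dprod_mul.
Proof. by move=> f; apply: functional_extensionality_dep => i; exact: mulVg. Qed.
Let dprod_mulrV : right_inverse dprod_one dprod_inv dprod_mul.
Proof. by move=> f; apply: functional_extensionality_dep => i; exact: mulgV. Qed.

HB.instance Definition _ := isGroup.Build (prod_topology T)
  dprod_mulA dprod_mul1 dprod_mulr1 dprod_mulV dprod_mulrV.

Let dprod_cvg (S : Type) (F : set_system S) (FF : Filter F)
    (u : S -> prod_topology T) (f : prod_topology T) :
  (forall i, (fun s => u s i) @ F --> f i) -> u @ F --> f.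
Proof.
move=> uf; apply/cvg_sup => i A [_ [[W oW <-] Wfi WA]].
by apply: (filterS WA); apply: (uf i); exact: open_nbhs_nbhs.
Qed.

Let dprod_proj i : continuous (fun f : prod_topology T => f i).
Proof. exact: (@proj_continuous _ T i). Qed.

Let dprod_mul_continuous :
  continuous (fun xy : prod_topology T * prod_topology T => xy.1 * xy.2).
Proof.
move=> [f g]; apply: dprod_cvg => i.
have := @cvgMg _ (nbhs (f, g)) _ (T i) (fun z => z.1 i) (fun z => z.2 i).
apply.
- exact: (cvg_comp _ _ (@cvg_fst _ _ (nbhs f) (nbhs g) _) (@dprod_proj i f)).
- exact: (cvg_comp _ _ (@cvg_snd _ _ (nbhs f) (nbhs g) _) (@dprod_proj i g)).
Qed.

Let dprod_inv_continuous : continuous (fun x : prod_topology T => x^-1).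
Proof.
move=> f; apply: (@dprod_cvg _ (nbhs f) (nbhs_filter f)) => i.
exact: (@cvgVg _ (nbhs f) (nbhs_filter f) (T i) (fun z => z i) _
  (@dprod_proj i f)).
Qed.

HB.instance Definition _ := Group_isTopologicalGroup.Build (prod_topology T)
  dprod_mul_continuous dprod_inv_continuous.
End ProductGroup.

Record subgroup (G : groupType) := Subgroup {
  subgroup_set :> set G ;
  subgroup_closed : group_closed (mem subgroup_set)
}.

HB.instance Definition _ (T : Type) (A : set T) :=
  SubType.copy (set_type A) {x : T | x \in A}.

HB.instance Definition _ (G : topGroupType) (H : subgroup G) :=
  SubChoice_isSubGroup.Build G _ (set_type (subgroup_set H))
    (subgroup_closed H).

Section SubgroupTopology.
Variables (G : topGroupType) (H : subgroup G).

Let set_val_continuous : continuous (@set_val G H).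
Proof. exact: initial_continuous. Qed.

Let sub_mul_continuous :
  continuous (fun xy : set_type H * set_type H => xy.1 * xy.2).
Proof.
apply: (@continuous_comp_initial _ _ G set_val) => -[x y].
have := @cvgMg _ (nbhs (x, y)) (nbhs_filter (x, y)) G
  (fun z => set_val z.1) (fun z => set_val z.2).
apply.
- exact: (cvg_comp _ _ (@cvg_fst _ _ (nbhs x) (nbhs y) _)
    (@set_val_continuous x)).
- exact: (cvg_comp _ _ (@cvg_snd _ _ (nbhs x) (nbhs y) _)
    (@set_val_continuous y)).
Qed.

Let sub_inv_continuous : continuous (fun x : set_type H => x^-1).
Proof.
apply: (@continuous_comp_initial _ _ G set_val) => x.
exact: (@cvgVg _ (nbhs x) (nbhs_filter x) G set_val _ (@set_val_continuous x)).
Qed.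

HB.instance Definition _ := Group_isTopologicalGroup.Build (set_type H)
  sub_mul_continuous sub_inv_continuous.

Definition subgroup_group : topGroupType := set_type H.
End SubgroupTopology.

(* Lets a subgroup stand where a topological group is expected; the carrier is
   the same set_type as given by the coercion through set. *)
Coercion subgroup_group : subgroup >-> topGroupType.

Lemma bigcap_group_closed (G : groupType) (I : Type) (D : set I)
    (F : I -> subgroup G) :
  group_closed (mem (\bigcap_(i in D) F i)).
Proof.
split=> [|x y]; rewrite ?inE.
  by move=> i _; have [/set_mem] := subgroup_closed (F i).
move=> Fx Fy i Di; have [_ FV] := subgroup_closed (F i).
by apply: set_mem; apply: FV; apply: mem_set; [exact: Fx|exact: Fy].
Qed.

Lemma setI_group_closed (G : groupType) (H K : subgroup G) :
  group_closed (mem (H `&` K)).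
Proof.
split=> [|x y]; rewrite ?inE.
  by split; apply: set_mem; [have [] := subgroup_closed H
                            |have [] := subgroup_closed K].
move=> [Hx Kx] [Hy Ky]; have [_ HV] := subgroup_closed H.
have [_ KV] := subgroup_closed K.
by split; apply: set_mem; [apply: HV|apply: KV]; exact: mem_set.
Qed.

Definition subgroupI (G : groupType) (H K : subgroup G) : subgroup G :=
  Subgroup (setI_group_closed H K).

Section GroupNotions.
Variable G : groupType.
Implicit Types H N : subgroup G.

Definition normalizer H : set G := [set g | [set x ^ g | x in H] = H].

Definition normal_subgroup N := normalizer N = [set: G].

Definition finite_index H :=
  finite_set [set [set g * x | x in H] | g in [set: G]].

End GroupNotions.

(* A `&` B is open in A for the subspace topology; B need not be included
   in A. *)
Definition open_in (T : topologicalType) (A B : set T) :=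
  @open (set_type A) (set_val @^-1` B).

Definition discrete_subset (T : topologicalType) (A : set T) :=
  A `<=` isolated A.

Definition tdlc (T : topologicalType) :=
  [/\ locally_compact [set: T], hausdorff_space T
    & totally_disconnected [set: T]].

Section TopologicalGroupNotions.
Variable G : topGroupType.
Implicit Types H K N : subgroup G.

Definition QZ : set G := [set x | open [set y : G | commute x y]].

Definition Res : subgroup G :=
  Subgroup (bigcap_group_closed
    [set N : subgroup G | open N /\ normal_subgroup N] id).

Definition topologically_simple :=
  [set: G] <> [set 1] /\
  forall N, closed N -> normal_subgroup N ->
    N = [set 1] :> set G \/ N = [set: G] :> set G.

Definition locally_normal H := open (normalizer H).

Definition locally_equivalent H K := open_in H K /\ open_in K H.

Definition local_class H : set (subgroup G) := [set K | locally_equivalent H K].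

(* The underlying set of the lattice; its order is not needed here. *)
Definition structure_lattice : set (set (subgroup G)) :=
  [set local_class H | H in [set H : subgroup G | closed H /\ locally_normal H]].

Definition profinite :=
  [/\ compact [set: G], hausdorff_space G & totally_disconnected [set: G]].

Definition just_infinite :=
  [/\ profinite, infinite_set [set: G]
    & forall N, closed N -> normal_subgroup N -> N <> [set 1] :> set G ->
        finite_index N].

End TopologicalGroupNotions.

Arguments QZ : clear implicits.
Arguments structure_lattice : clear implicits.

Definition hereditarily_just_infinite (G : topGroupType) :=
  profinite G /\ forall U : subgroup G, open U -> just_infinite U.

Definition topgroup_isomorphism (G H : topGroupType) (f : G -> H) :=
  [/\ {morph f : x y / x * y}, continuous f
    & exists g : H -> G, [/\ cancel f g, cancel g f & continuous g]].

Definition isomorphic (G H : topGroupType) :=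
  exists f : G -> H, topgroup_isomorphism f.

Definition characteristic (G : topGroupType) (H : subgroup G) :=
  forall f : G -> G, topgroup_isomorphism f -> f @` H = H.

(* Q = P 0 \x ... \x P (n - 1) as topological groups: multiplication is an
   isomorphism from the group with the product topology onto Q. *)
Definition internal_direct_product (G : topGroupType) (n : nat)
    (P : 'I_n -> subgroup G) (Q : subgroup G) :=
  exists f : prod_topology (fun i => P i) -> Q,
    topgroup_isomorphism f /\
    forall x, set_val (f x) = \prod_(i < n) (set_val (x i) : G).

(* The finiteness of the structure lattice is part of the equipotence. *)
Definition type_JH (n : nat) (G : topGroupType) :=
  [/\ tdlc G,
      ~ discrete_subset [set: G],
      discrete_subset (QZ G),
      structure_lattice G #= `I_(2 ^ n)
    & exists (L : topGroupType) (U : subgroup G),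
        [/\ hereditarily_just_infinite L, open U
          & isomorphic U (prod_topology (fun _ : 'I_n => L))]].

Definition exactly_one3 (A B C : Prop) :=
  [\/ [/\ A, ~ B & ~ C], [/\ ~ A, B & ~ C] | [/\ ~ A, ~ B & C]].

Section FactorTypes.
Variables (G : topGroupType) (P : subgroup G).

Definition reducible_type := P `&` Res G = [set 1].

Definition mysterious_type :=
  open_in P (Res G) /\ P `&` set_val @` Res (Res G) = [set 1].

Definition simple_type :=
  [/\ P `&` Res G = set_val @` Res P, open_in P (Res G)
    & topologically_simple (subgroupI P (Res G))].

End FactorTypes.

(* Main.v *)
Require Import Defs.
From mathcomp Require Import all_boot perm.
From mathcomp Require Import all_classical topology.

Set Implicit Arguments.
Unset Strict Implicit.
Unset Printing Implicit Defensive.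

Local Open Scope classical_set_scope.
Local Open Scope group_scope.

(** Let [U] be an open subgroup of [G] that is a direct product of copies
[L_1, ..., L_n] of a hereditarily just infinite group [L].  The factors [L_i]
are far from canonical, but their germs at [1] are, and the proof works with
germs throughout: properties are asserted for all elements of [L_i], or of [G],
that are close enough to [1].

Since [QZ(G) = 1], an element that commutes with the elements of every [L_j]
close to [1] is trivial ([germ_commute_eq1]).  Hence equations between elements
of [G] can be tested on germs.  The factor [P_i] ([local_factor]) consists of
the elements that commute, for every [j] other than [i], with the elements of
[L_j] close to [1].  It depends only on the germs of the [L_j], and it coincides
with [L_i] near [1] ([near_factor]); so it is locally isomorphic to [L].  For
distinct [i] and [j] the commutators of [P_i] with [P_j] pass the germ test, so
these groups commute ([factor_commute]), and multiplication maps their direct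
product isomorphically onto an open subgroup of [G] ([factor_product_direct]).

The tool for everything else is a dichotomy ([factor_dichotomy]): a closed
subgroup [B] with open normalizer contains a neighbourhood of [1] in [L_i], or
meets [P_i] trivially.  Indeed, the trace of [B] on a small open subgroup of
[L_i] is normal there, and that subgroup is just infinite.

For an automorphism [f] of [G], apply this to the subgroup [f(L_i)].  It cannot
meet every [P_j] trivially, because it would then be discrete by the germ test;
so it has the germ of some [L_j], and [f] permutes the germs of the factors,
thus also the [P_i] ([factor_aut]).

For the three types, write [R] for [Res(G)] and [S] for [Res(R)]; both are
closed and normal in [G].  The dichotomy for [R] singles out the reducible
type, and the dichotomy for [S] then singles out the mysterious type.  In the
remaining case [S] contains a neighbourhood of [1] in [P_i].  For every index
[j] with this property, the subgroup [(P_j `&` S) C(P_j)] is open; conjugation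
by [G] permutes these subgroups because it permutes the [P_j].  Their
intersection is open and normal in [G], so it contains [R]
([Res_sub_mul_centralizer]), and therefore [T = P_i `&` R] is contained in [S].
Moreover [R] is contained in [T C(P_i)], so a closed normal subgroup [O] of [T]
gives a subgroup [O C(P_i)] which is normalized by [R].  If [O] is nontrivial, it contains a neighbourhood
of [1] in [P_i] by the dichotomy, [O C(P_i)] is open, its trace on [R] contains
[S = Res(R)], and [O = T].  So [T] is topologically simple ([trace_simple]),
which also forces [Res(P_i) = T] ([Res_factor]).  Finally, a nondiscrete
topologically simple [T] lies in every open normal subgroup of [R], hence in
[S]; this separates the mysterious type from the simple type. *)

Local Notation "x ∈ H" := (subgroup_set H x) (at level 70, no associativity).

(** * Subgroups, normalizers and centralizers *)

Section SubgroupBasics.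
Variable G : groupType.
Implicit Types (H K N : subgroup G) (A B : set G) (x y : G).

Lemma subgroup1 H : 1 ∈ H.
Proof. by have [/set_mem] := subgroup_closed H. Qed.

Lemma subgroupF H x y : x ∈ H -> y ∈ H -> x / y ∈ H.
Proof.
have [_ HF] := subgroup_closed H.
by move=> Hx Hy; apply: set_mem; apply: HF; exact: mem_set.
Qed.

Lemma subgroupV H x : x ∈ H -> x^-1 ∈ H.
Proof.
by move=> Hx; rewrite -div1g; apply: subgroupF => //; exact: subgroup1.
Qed.

Lemma subgroupM H x y : x ∈ H -> y ∈ H -> x * y ∈ H.
Proof. by move=> Hx Hy; rewrite -[y]invgK; apply/subgroupF/subgroupV. Qed.

Lemma subgroupJ H x y : x ∈ H -> y ∈ H -> x ^ y ∈ H.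
Proof.
move=> Hx Hy; rewrite conjgE; apply: subgroupM (subgroupM _ _) => //.
exact: subgroupV.
Qed.

Lemma group_closedP A :
  A 1 -> (forall x y, A x -> A y -> A (x / y)) -> group_closed (mem A).
Proof.
move=> A1 AF; split=> [|x y]; rewrite ?inE // => Ax Ay; exact: AF.
Qed.

Lemma normalizerJ H g x : normalizer H g -> x ∈ H -> x ^ g ∈ H.
Proof. by move=> Ng Hx; rewrite -Ng; exists x. Qed.

Lemma mem_normalizer H g :
  (forall x, x ∈ H -> x ^ g ∈ H) -> (forall x, x ∈ H -> x ^ g^-1 ∈ H) ->
  normalizer H g.
Proof.
move=> Hg HgV; apply/seteqP; split=> [_ [x Hx <-]|x Hx]; first exact: Hg.
by exists (x ^ g^-1); [exact: HgV | exact: conjgKV].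
Qed.

Lemma normalizer_closed H : group_closed (mem (normalizer H)).
Proof.
have NV g : normalizer H g -> forall x, x ∈ H -> x ^ g^-1 ∈ H.
  by move=> Ng x; rewrite -[in X in X -> _]Ng => -[y Hy <-]; rewrite conjgK.
apply: group_closedP => [|x y Nx Ny].
  by apply: mem_normalizer => x Hx; rewrite ?invg1 conjg1.
apply: mem_normalizer => z Hz; rewrite ?invgF conjgM.
  exact/(NV y Ny)/normalizerJ.
exact/(NV x Nx)/normalizerJ.
Qed.

Definition normalizer_subgroup H := Subgroup (normalizer_closed H).

Lemma normal_subgroupP N :
  normal_subgroup N <-> forall x g, x ∈ N -> x ^ g ∈ N.
Proof.
split=> [NT x g Nx|NJ].
  by apply: normalizerJ Nx; rewrite [normalizer N]NT.
by apply/seteqP; split=> // g _; apply: mem_normalizer => x; exact: NJ.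
Qed.

Definition centralizer A : set G := [set x | forall y, A y -> commute x y].

Lemma centralizer_closed A : group_closed (mem (centralizer A)).
Proof.
apply: group_closedP => [y _|x y Cx Cy z Az]; first exact/commute_sym/commute1.
apply/commute_sym/commuteM; first exact/commute_sym/Cx.
exact/commuteV/commute_sym/Cy.
Qed.

Definition centralizer_subgroup A := Subgroup (centralizer_closed A).

Lemma commuteJ x y g : commute x y -> commute (x ^ g) (y ^ g).
Proof. by move=> xy; rewrite /commute -!conjMg xy. Qed.

Lemma conjg_commute x y : commute x y -> x ^ y = x.
Proof. by move=> xy; rewrite conjgE xy mulKg. Qed.

Lemma mul_centralizer_closed H A : H `<=` A ->
  group_closed (mem [set x * y | x in H & y in centralizer A]).
Proof.
move=> HA; apply: group_closedP => [|_ _ [x Hx [y Cy <-]] [x' Hx' [y' Cy' <-]]].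
  exists 1; first exact: subgroup1.
  by exists 1; [exact: (subgroup1 (centralizer_subgroup A)) | rewrite mulg1].
exists (x / x'); first exact: subgroupF.
exists (y / y'); first exact: (@subgroupF (centralizer_subgroup A)).
have c : commute (y / y') x'^-1.
  by apply: (@subgroupF (centralizer_subgroup A)) => //; exact/HA/subgroupV.
by rewrite invgM -mulgA -c !mulgA.
Qed.

(** Because [H] lies in [A], it commutes with the centralizer of [A], so the
product set of the two is a group. *)
Definition mul_centralizer H A (HA : H `<=` A) :=
  Subgroup (mul_centralizer_closed HA).

Lemma centralizerJ A x g : (forall z, A z -> A (z ^ g^-1)) ->
  centralizer A x -> centralizer A (x ^ g).
Proof.
move=> AJ Cx z Az; rewrite -(conjgKV g z); apply: commuteJ; apply: Cx.
exact: AJ.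
Qed.

End SubgroupBasics.

(** * Topological groups near the identity *)

Lemma morphg1 (G H : groupType) (f : G -> H) :
  {morph f : x y / x * y} -> f 1 = 1.
Proof. by move=> fM; apply: (mulgI (f 1)); rewrite -fM !mulg1. Qed.

Lemma morphgV (G H : groupType) (f : G -> H) :
  {morph f : x y / x * y} -> {morph f : x / x^-1}.
Proof.
move=> fM x; apply: (mulgI (f x)).
by rewrite -fM !mulgV (morphg1 fM).
Qed.

Lemma morphgJ (G H : groupType) (f : G -> H) :
  {morph f : x y / x * y} -> {morph f : x y / x ^ y}.
Proof. by move=> fM x y; rewrite !conjgE !fM morphgV. Qed.

Lemma morph_commute (G H : groupType) (f : G -> H) x y :
  {morph f : x y / x * y} -> commute x y -> commute (f x) (f y).
Proof. by move=> fM xy; rewrite /commute -!fM xy. Qed.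

Section Germs.
Variable G : topGroupType.
Implicit Types (H K N : subgroup G) (A B : set G) (x y g : G).

Lemma cvg_mul2l a x : (fun y => a * y) @ x --> a * x.
Proof. by apply: cvgMg; [exact: cvg_cst | exact: cvg_id]. Qed.

Lemma near1_translate x A : nbhs x A -> \forall y \near (1 : G), A (x * y).
Proof. by have := @cvg_mul2l x 1; rewrite mulg1; exact. Qed.

Lemma near_translate x A :
  (\forall y \near (1 : G), A y) -> \forall y \near x, A (x^-1 * y).
Proof. by have := @cvg_mul2l x^-1 x; rewrite mulVg; exact. Qed.

Lemma near1_conj x A :
  (\forall y \near (1 : G), A y) -> \forall y \near (1 : G), A (y ^ x).
Proof.
move=> nA; have c : (fun y => y ^ x) @ (1 : G) --> (1 : G).
  rewrite -[X in _ --> X](conj1g x).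
  apply: cvgMg; first exact: cvg_cst.
  by apply: cvgMg; [exact: cvg_id | exact: cvg_cst].
exact: c.
Qed.

Lemma near1_commg x A :
  (\forall y \near (1 : G), A y) -> \forall y \near (1 : G), A (x^-1 * x ^ y).
Proof.
move=> nA; have c : (fun y => x^-1 * x ^ y) @ (1 : G) --> (1 : G).
  have e : x^-1 * (1^-1 * (x * 1)) = 1 by rewrite invg1 mulg1 mul1g mulVg.
  rewrite -[X in _ --> X]e.
  apply: cvgMg; first exact: cvg_cst.
  apply: cvgMg; first by apply: cvgVg; exact: cvg_id.
  by apply: cvgMg; [exact: cvg_cst | exact: cvg_id].
exact: c.
Qed.

Lemma near1_mem H : open H -> \forall g \near (1 : G), g ∈ H.
Proof. by move=> oH; apply: open_nbhs_nbhs; split=> //; exact: subgroup1. Qed.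

Lemma subgroup_open H : (\forall g \near (1 : G), g ∈ H) -> open H.
Proof.
move=> nH; rewrite openE => x Hx; rewrite /interior.
apply: filterS (near_translate x nH) => y Hy.
by rewrite -[y](mulVKg x); exact: subgroupM.
Qed.

(** If [x] is a limit of [N], it lies in [H], and some element of [N] differs
from [x] by an element of [H] close to [1], which belongs to [N]. *)
Lemma relatively_open_closed H N : closed H -> N `<=` H ->
  (\forall g \near (1 : G), g ∈ H -> g ∈ N) -> closed N.
Proof.
move=> cH NH nN x clNx.
have Hx : x ∈ H.
  apply: cH => A xA; have [y [Ny Ay]] := clNx A xA.
  by exists y; split=> //; exact: NH.
have [y [Ny /(_ _)]] := clNx _ (near_translate x nN).
move=> Hy; have {}Hy : x^-1 * y ∈ N.
  by apply: Hy; apply: subgroupM; [exact: subgroupV | exact: NH].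
by rewrite -[x](mulgK (x^-1 * y)) mulVKg; exact: subgroupF.
Qed.

Lemma open_subgroup_closed H : open H -> closed H.
Proof.
move=> oH; have cT : group_closed (mem [set: G]) by exact: group_closedP.
apply: (@relatively_open_closed (Subgroup cT)) => //.
by apply: filterS (near1_mem oH).
Qed.

Lemma QZ_near1 x : (\forall y \near (1 : G), commute x y) -> QZ G x.
Proof.
move=> nx; rewrite /QZ /=.
have -> : [set y | commute x y] = centralizer_subgroup [set x].
  apply/seteqP; split=> y /=; first by move=> xy _ ->; exact/commute_sym.
  by move=> Cy; exact/commute_sym/Cy.
apply: subgroup_open; apply: filterS nx => y xy _ -> /=; exact/commute_sym.
Qed.

Lemma near1_QZ x : QZ G x -> \forall y \near (1 : G), commute x y.
Proof. by move=> Qx; apply: open_nbhs_nbhs; split=> //; exact: commute1. Qed.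

Lemma closed_commute y : hausdorff_space G -> closed [set x | commute x y].
Proof.
move=> /hausdorff_accessible/accessible_closed_set1 cl1.
have -> : [set x | commute x y] = (fun x => x^-1 * x ^ y) @^-1` [set 1].
  apply/seteqP; split=> x /=; first by move/conjg_commute => ->; exact: mulVg.
  by move=> c1; apply/commgP/eqP.
apply: (continuous_closedP _).1 (cl1 1) => x.
apply: cvgMg; first by apply: cvgVg; exact: cvg_id.
apply: cvgMg; first exact: cvg_cst.
by apply: cvgMg; [exact: cvg_id | exact: cvg_cst].
Qed.

Lemma closed_centralizer A : hausdorff_space G -> closed (centralizer A).
Proof.
move=> hG; have -> : centralizer A = \bigcap_(y in A) [set x | commute x y].
  by [].
by apply: closed_bigI => y _; exact: closed_commute.
Qed.

(** The complement is a finite union of cosets, each of which is closed. *)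
Lemma finite_index_open H : closed H -> finite_index H -> open H.
Proof.
move=> cH fH; set C := [set [set g * x | x in H] | g in [set: G]] in fH.
have -> : subgroup_set H = ~` \bigcup_(D in C `\ (H : set G)) D.
  apply/seteqP; split=> [x Hx [D [[g _ <-] /= nH] [y Hy yx]]|x nx].
    apply: nH; apply/seteqP; split=> z.
      move=> [t Ht <-]; have -> : g = x / y by rewrite -yx mulgK.
      by apply: subgroupM => //; exact: subgroupF.
    move=> Hz; exists (y * (x^-1 * z)).
      by apply: subgroupM => //; apply: subgroupM => //; exact: subgroupV.
    by rewrite mulgA yx mulVKg.
  apply: contrapT => Hx; apply: nx; exists [set x * y | y in H].
    split; first by exists x.
    move=> /= e; apply: Hx; rewrite -e.
    by exists 1; [exact: subgroup1 | exact: mulg1].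
  by exists 1; [exact: subgroup1 | exact: mulg1].
apply: closed_openC; apply: closed_bigcup; first exact: finite_setD.
move=> _ [[g _ <-] _].
have -> : [set g * x | x in H] = (fun y => g^-1 * y) @^-1` H.
  apply/seteqP; split=> [_ [x Hx <-]|y Hy] /=; first by rewrite mulKg.
  by exists (g^-1 * y) => //; exact: mulVKg.
by apply: (continuous_closedP _).1 cH => x; exact: cvg_mul2l.
Qed.

End Germs.

Lemma morph_continuous (G H : topGroupType) (f : G -> H) :
  {morph f : x y / x * y} -> f @ (1 : G) --> (1 : H) -> continuous f.
Proof.
move=> fM f1 x A /near1_translate nA.
have {}nA : \forall y \near (1 : G), A (f x * f y) := f1 _ nA.
apply: filterS (near_translate x nA) => y /=.
by rewrite -fM mulVKg.
Qed.

(** Moves germs at the identity between a subgroup and the ambient group; it is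
what allows topological statements about subgroups, and about subgroups of
subgroups, to be proved inside one group. *)
Lemma near1_subgroup (G : topGroupType) (H : subgroup G) (A : set H) :
  (\forall h \near (1 : H), A h) <->
  (\forall g \near (1 : G), forall h : H, set_val h = g -> A h).
Proof.
split=> [[_ [[B oB <-] /= B1] BA]|nA].
  have nB : nbhs (1 : G) B by apply: open_nbhs_nbhs; split=> //.
  by apply: filterS nB => g Bg h hg; apply: BA; rewrite /= hg.
have nA' : nbhs (set_val (1 : H)) [set g | forall h : H, set_val h = g -> A h].
  exact: nA.
have c : continuous (@set_val G H) by exact: initial_continuous.
have {}nA : \forall h \near (1 : H),
    forall h' : H, set_val h' = set_val h -> A h'.
  exact: c _ _ nA'.
by apply: filterS nA => h; exact.
Qed.

(** * The residual of a subgroup *)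

Section SubgroupMorphisms.
Variables (G H : groupType) (f : G -> H).
Hypothesis fM : {morph f : x y / x * y}.

Lemma morph_preimage_closed (K : subgroup H) :
  group_closed (mem [set x | f x ∈ K]).
Proof.
apply: group_closedP => [|x y /= Kx Ky].
  by rewrite /= morphg1 //; exact: subgroup1.
by rewrite fM morphgV //; exact: subgroupF.
Qed.

Lemma morph_image_closed (K : subgroup G) :
  group_closed (mem [set f x | x in K]).
Proof.
apply: group_closedP => [|_ _ [x Kx <-] [y Ky <-]].
  by exists 1; [exact: subgroup1 | exact: morphg1].
by exists (x / y); [exact: subgroupF | rewrite fM morphgV].
Qed.

Definition preim_subgroup (K : subgroup H) :=
  Subgroup (morph_preimage_closed K).
Definition im_subgroup (K : subgroup G) := Subgroup (morph_image_closed K).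

End SubgroupMorphisms.

Lemma setT_closed (G : groupType) : group_closed (mem [set: G]).
Proof. exact: group_closedP. Qed.

Definition subgroupT (G : groupType) := Subgroup (@setT_closed G).

Section Subgroups.
Variable G : topGroupType.
Implicit Types (H K : subgroup G) (x y g : G).

Lemma set_valM H : {morph @set_val G H : x y / x * y}.
Proof. by []. Qed.

Lemma set_val_mem H (h : H) : set_val h ∈ H.
Proof. exact: set_valP. Qed.

Lemma mem_set_val H x : x ∈ H -> exists h : H, set_val h = x.
Proof. by move=> Hx; exists (SigSub (mem_set Hx)). Qed.

Lemma set_val_inj H : injective (@set_val G H).
Proof. exact: val_inj. Qed.

Definition sub_trace H K : subgroup H := preim_subgroup (@set_valM H) K.
Definition sub_extension H (K : subgroup H) : subgroup G :=
  im_subgroup (@set_valM H) K.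

Lemma set_val_continuous H : continuous (@set_val G H).
Proof. exact: initial_continuous. Qed.

Lemma open_inP H K :
  open_in H K <-> \forall g \near (1 : G), g ∈ H -> g ∈ K.
Proof.
rewrite /open_in; split=> [oK|nK].
  have /near1_subgroup := near1_mem (oK : open (sub_trace H K)).
  apply: filterS => g Kg /mem_set_val[h hg].
  by have := Kg h hg; rewrite -[in X in _ -> X]hg.
apply: (@subgroup_open H (sub_trace H K)); apply/near1_subgroup.
apply: filterS nK => g HK h hg /=; rewrite hg; apply: HK; rewrite -hg.
exact: set_val_mem.
Qed.

Lemma Res_subP (x : G) : x ∈ Res G <->
  forall N : subgroup G, (\forall g \near (1 : G), g ∈ N) ->
    (forall y g, y ∈ N -> y ^ g ∈ N) -> x ∈ N.
Proof.
split=> [Rx N nN NJ|RN N [oN /normal_subgroupP NJ]].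
  by apply: Rx; split; [exact: subgroup_open | exact/normal_subgroupP].
exact: RN (near1_mem oN) NJ.
Qed.

Lemma Res_normal (x g : G) : x ∈ Res G -> x ^ g ∈ Res G.
Proof.
by move=> /Res_subP Rx; apply/Res_subP => N nN NJ; exact: NJ (Rx N nN NJ).
Qed.

Lemma Res_closed : closed (Res G).
Proof.
apply: closed_bigI => N [oN _]; exact: open_subgroup_closed oN.
Qed.

End Subgroups.

Section ResiduumOfSubgroup.
Variable G : topGroupType.
Implicit Types (H K : subgroup G) (x y g : G).

(** The subgroups [N] live in the ambient group, so that they can be conjugated
by elements outside [H]. *)
Lemma image_ResP H x : (set_val @` Res H) x <->
  x ∈ H /\ forall N : subgroup G, N `<=` H ->
    (\forall g \near (1 : G), g ∈ H -> g ∈ N) ->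
    (forall y g, y ∈ N -> g ∈ H -> y ^ g ∈ N) -> x ∈ N.
Proof.
split=> [[h Rh <-]|[/mem_set_val[h <-] RN]].
  split=> [|N NH nN NJ]; first exact: set_val_mem.
  apply: ((Res_subP h).1 Rh (sub_trace H N)).
    exact/near1_mem/open_inP.
  by move=> y g /= Ny; exact: NJ (set_val_mem g).
exists h => //; apply/Res_subP => N nN NJ.
have [|||n Nn /set_val_inj<- //] := RN (sub_extension N).
- by move=> _ [n _ <-]; exact: set_val_mem.
- move/near1_subgroup: nN; apply: filterS => g Ng /mem_set_val[k kg].
  by exists k => //; exact: Ng.
- move=> _ _ [y Ny <-] /mem_set_val[g <-].
  by exists (y ^ g) => //; exact: NJ.
Qed.

(** Conjugation by [g] maps open normal subgroups of [H] to open normal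
subgroups of [H]. *)
Lemma image_Res_normal H x g : normal_subgroup H ->
  (set_val @` Res H) x -> (set_val @` Res H) (x ^ g).
Proof.
move=> /normal_subgroupP HJ /image_ResP[Hx Rx]; apply/image_ResP.
split=> [|N NH nN NJ]; first exact: HJ.
have gM : {morph (fun y : G => y ^ g) : y z / y * z}.
  by move=> y z; exact: conjMg.
have HJV y : y ^ g ∈ H -> y ∈ H by move=> /(HJ _ g^-1); rewrite conjgK.
apply: (Rx (preim_subgroup gM N)) => [y /NH /HJV //||y h /= Ny Hh].
  by apply: filterS (near1_conj g nN) => y Ny Hy; exact/Ny/HJ.
by rewrite conjJg; apply: NJ => //; exact: HJ.
Qed.

End ResiduumOfSubgroup.

(** * Closed normal subgroups of closed subgroups *)

Section ClosedSubgroups.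
Variable G : topGroupType.
Implicit Types (H K N : subgroup G) (x y g : G).

Lemma closed_sub_trace H N : closed N -> closed (sub_trace H N).
Proof. exact: (continuous_closedP _).1 (@set_val_continuous G H) N. Qed.

Lemma closed_sub_extension H (N : subgroup H) :
  closed H -> closed N -> closed (sub_extension N).
Proof.
move=> cH cN x clx.
have /mem_set_val[h hx] : x ∈ H.
  apply: cH => A /clx[_ [[n _ <-] An]].
  by exists (set_val n); split=> //; exact: set_val_mem.
exists h => //; apply: cN => B [_ [[W oW <-] Wh WB]].
have [_ [[n Nn <-] Wn]] : sub_extension N `&` W !=set0.
  by apply: clx; apply: open_nbhs_nbhs; split=> //; rewrite -hx.
by exists n; split=> //; exact: WB.
Qed.

Lemma image_Res_closed H : closed H -> closed (sub_extension (Res H)).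
Proof. by move=> cH; exact: closed_sub_extension cH (@Res_closed H). Qed.

Lemma topologically_simpleP H : closed H ->
  topologically_simple H <->
  subgroup_set H <> [set 1] /\
  forall N, N `<=` H -> closed N ->
    (forall y g, y ∈ N -> g ∈ H -> y ^ g ∈ N) ->
    N = [set 1] :> set G \/ N = H :> set G.
Proof.
move=> cH; split=> -[H1 simpleH]; split.
- move=> eH; apply: H1; apply/seteqP; split=> // h _ /=.
  have sub1 : H `<=` [set 1] by rewrite eH.
  exact/set_val_inj/(sub1 _ (set_val_mem h)).
- move=> N NH cN NJ.
  have [||e|e] := simpleH (sub_trace H N).
  + exact: closed_sub_trace.
  + by apply/normal_subgroupP => y g /= Ny; exact: NJ (set_val_mem g).
  + left; apply/seteqP; split=> [x Nx|_ ->]; last exact: subgroup1.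
    have /mem_set_val[h hx] := NH _ Nx.
    have : h ∈ sub_trace H N by rewrite /= hx.
    by rewrite e /= => h1; rewrite -hx h1.
  + right; apply/seteqP; split=> // x /mem_set_val[h <-].
    have : [set: H] h by [].
    by rewrite -e.
- move=> e; apply: H1; apply/seteqP.
  split=> [x /mem_set_val[h <-]|_ ->]; last exact: subgroup1.
  have : [set: H] h by [].
  by rewrite e /= => ->.
- move=> N cN /normal_subgroupP NJ.
  have [|||e|e] := simpleH (sub_extension N).
  + by move=> _ [n _ <-]; exact: set_val_mem.
  + exact: closed_sub_extension.
  + move=> _ _ [y Ny <-] /mem_set_val[g <-].
    by exists (y ^ g) => //; exact: NJ.
  + left; apply/seteqP; split=> [n Nn|_ ->]; last exact: subgroup1.
    have : set_val n ∈ sub_extension N by exists n.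
    by rewrite e /= => n1; exact: set_val_inj.
  + right; apply/seteqP; split=> // h _.
    have HN : H `<=` sub_extension N by rewrite e.
    by have [n Nn /set_val_inj <-] := HN _ (set_val_mem h).
Qed.

End ClosedSubgroups.

(** The trace of [N] on [V] is a closed normal subgroup of a just infinite
group: if it is not trivial, it has finite index, hence is open. *)
Lemma just_infinite_dichotomy (G : topGroupType) (V N : subgroup G) :
  hereditarily_just_infinite G -> open V -> closed N ->
  (forall y g, y ∈ N -> g ∈ V -> y ^ g ∈ N) ->
  (forall x, x ∈ N -> x ∈ V -> x = 1) \/ \forall g \near (1 : G), g ∈ N.
Proof.
move=> [_ hG] oV cN NJ; have [_ _ jiV] := hG V oV.
have cNV : closed (sub_trace V N) by exact: closed_sub_trace.
have [e|ne] := pselect (sub_trace V N = [set 1] :> set V).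
  left=> x Nx /mem_set_val[v vx].
  have : v ∈ sub_trace V N by rewrite /= vx.
  by rewrite e /= => v1; rewrite -vx v1.
right; have /finite_index_open oNV : finite_index (sub_trace V N).
  apply: jiV ne => //; apply/normal_subgroupP => y g /= Ny.
  exact: NJ (set_val_mem g).
have /near1_subgroup nN := near1_mem (oNV cNV).
apply: filterS2 nN (near1_mem oV) => g Ng /mem_set_val[v vg].
by have := Ng v vg; rewrite /= vg.
Qed.

(** * Direct products and isomorphisms *)

(** The hypothesis concerns distinct indices only, since the elements [x i] and
[y i] of one factor need not commute; each index must then occur at most once. *)
Lemma prodgM_uniq (G : groupType) (I : eqType) (r : seq I) (x y : I -> G) :
  uniq r -> (forall i j, i != j -> commute (x i) (y j)) ->
  \prod_(i <- r) (x i * y i) = \prod_(i <- r) x i * \prod_(i <- r) y i.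
Proof.
move=> + xy; elim: r => [|i r IHr] /=; first by rewrite !big_nil mulg1.
move=> /andP[ir ur]; rewrite !big_cons IHr // -!mulgA; congr (_ * _).
rewrite !mulgA; congr (_ * _).
rewrite big_seq; apply: commute_prod => j jr.
by apply/commute_sym/xy; apply: contraNneq ir => <-.
Qed.

Lemma near_forall_fin (T : Type) (F : set_system T) {FF : Filter F}
    (I : finType) (A : I -> set T) :
  (forall i, \forall x \near F, A i x) -> \forall x \near F, forall i, A i x.
Proof.
move=> nA.
have nS (s : seq I) : \forall x \near F, forall i, i \in s -> A i x.
  elim: s => [|i s IHs]; first exact: nearW.
  apply: filterS2 (nA i) IHs => x Ax As j.
  by rewrite inE => /predU1P[->|] //; exact: As.
by apply: filterS (nS (enum I)) => x Ax i; apply: Ax; rewrite mem_enum.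
Qed.

Section ProductTopology.
Variables (I : finType) (T : I -> topGroupType).
Implicit Types x : prod_topology T.

Lemma prod_cvg (S : Type) (F : set_system S) {FF : Filter F}
    (u : S -> prod_topology T) x :
  (forall i, (fun s => u s i) @ F --> x i) -> u @ F --> x.
Proof.
move=> ux; apply/cvg_sup => i A [_ [[W oW <-] Wxi WA]].
by apply: (filterS WA); apply: (ux i); exact: open_nbhs_nbhs.
Qed.

Lemma near_coord x i (A : set (T i)) :
  nbhs (x i) A -> \forall y \near x, A (y i).
Proof. exact: (@proj_continuous _ T i x A). Qed.

Lemma near_box (A : forall i, set (T i)) :
  (forall i, \forall l \near (1 : T i), A i l) ->
  \forall x \near (1 : prod_topology T), forall i, A i (x i).
Proof.
move=> nA; have nA' i : \forall x \near (1 : prod_topology T), A i (x i).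
  exact: (@near_coord 1 i _ (nA i)).
exact: (near_forall_fin (FF := nbhs_filter (1 : prod_topology T)) nA').
Qed.

End ProductTopology.

Section Single.
Variables (n : nat) (L : topGroupType).
Local Notation Ln := (prod_topology (fun _ : 'I_n => L)).

Definition single (i : 'I_n) (l : L) : Ln := fun j => if j == i then l else 1.

Lemma single_id i l : single i l i = l.
Proof. by rewrite /single eqxx. Qed.

Lemma single_neq i j l : j != i -> single i l j = 1.
Proof. by rewrite /single => /negPf->. Qed.

Lemma singleM i : {morph single i : x y / x * y}.
Proof.
move=> x y; apply: functional_extensionality_dep => j.
have -> : (single i x * single i y) j = single i x j * single i y j by [].
by rewrite /single; case: eqP => // _; rewrite mulg1.
Qed.

Lemma single_cvg i : single i @ (1 : L) --> (1 : Ln).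
Proof.
apply: prod_cvg => j; rewrite /single; case: eqP => _; first exact: cvg_id.
exact: cvg_cst.
Qed.

Lemma prod_single (x : Ln) : x = \prod_(i < n) single i (x i).
Proof.
apply: functional_extensionality_dep => j.
have ev : {morph (fun y : Ln => y j) : x y / x * y >-> x * y} by [].
rewrite (big_morph _ ev (erefl : (1 : Ln) j = 1)).
rewrite /single (eq_bigr (fun i => if i == j then x i else 1)).
  by rewrite -big_mkcond big_pred1_eq.
by move=> i _; rewrite eq_sym.
Qed.

End Single.

Lemma inverse_morph (G H : groupType) (f : G -> H) (g : H -> G) :
  {morph f : x y / x * y} -> cancel f g -> cancel g f ->
  {morph g : x y / x * y}.
Proof. by move=> fM fK gK x y; rewrite -{1}(gK x) -{1}(gK y) -fM fK. Qed.

Section OpenBijections.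
Variables (G H : topGroupType) (f : G -> H).
Hypothesis fM : {morph f : x y / x * y}.

Lemma open_bijection_isomorphism :
  injective f -> (forall h, exists g, f g = h) -> f @ (1 : G) --> (1 : H) ->
  (forall A : set G, (\forall g \near (1 : G), A g) ->
    \forall h \near (1 : H), exists2 g, A g & f g = h) ->
  topgroup_isomorphism f.
Proof.
move=> f_inj /choice[g gK] f1 fo.
have fK : cancel f g by move=> x; exact/f_inj/gK.
split=> //; first exact: morph_continuous.
exists g; split=> //; apply: morph_continuous; first exact: inverse_morph gK.
move=> A nA; have := fo A nA; apply: filterS => _ [x Ax <-].
by rewrite /= fK.
Qed.

End OpenBijections.

Lemma isomorphic_sym (G H : topGroupType) : isomorphic G H -> isomorphic H G.
Proof.
move=> [f [fM fc [g [fK gK gc]]]]; exists g; split=> //.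
  exact: inverse_morph fK gK.
by exists f.
Qed.

Lemma cvg_prodg (S I : Type) (F : set_system S) {FF : Filter F}
    (G : topGroupType) (r : seq I) (u : I -> S -> G) :
  (forall i, u i @ F --> (1 : G)) ->
  (fun s => \prod_(i <- r) u i s) @ F --> (1 : G).
Proof.
move=> u1; elim: r => [|i r IHr].
  under eq_fun do rewrite big_nil.
  exact: cvg_cst.
under eq_fun do rewrite big_cons.
by have := cvgMg FF (u1 i) IHr; rewrite mulg1.
Qed.

Lemma cvg_subgroup (S : Type) (F : set_system S) {FF : Filter F}
    (G : topGroupType) (H : subgroup G) (u : S -> H) h :
  (fun s => set_val (u s)) @ F --> (set_val h : G) -> u @ F --> h.
Proof.
move=> uh A [_ [[W oW <-] Wh WA]].
have nW : nbhs (set_val h : G) W by exact: open_nbhs_nbhs.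
have nFW : F (fun s => W (set_val (u s))) by exact: uh _ nW.
by apply: filterS nFW => s; exact: WA.
Qed.

(** * Groups that are locally a power of one group *)

(** The map [E] is an isomorphism of the power of [L] onto an open subgroup of
[G]; its continuity and openness are expressed at the identity. *)
Section LocalProduct.
Variables (n : nat) (G L : topGroupType).
Local Notation Ln := (prod_topology (fun _ : 'I_n => L)).
Variable E : Ln -> G.
Hypothesis EM : {morph E : x y / x * y}.
Hypothesis E_inj : injective E.
Hypothesis E_cvg : E @ (1 : Ln) --> (1 : G).
Hypothesis E_open : forall A : set Ln, (\forall x \near (1 : Ln), A x) ->
  \forall g \near (1 : G), exists2 x, A x & E x = g.
Hypothesis G_hausdorff : hausdorff_space G.
Hypothesis QZ1 : QZ G = [set 1].
Hypothesis L_hji : hereditarily_just_infinite L.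
Hypothesis L_nondiscrete : ~ \forall l \near (1 : L), l = 1.

Definition emb i l : G := E (single i l).

Lemma embM i : {morph emb i : x y / x * y}.
Proof. by move=> x y; rewrite /emb singleM EM. Qed.

Lemma emb1 i : emb i 1 = 1.
Proof. exact: morphg1 (embM i). Qed.

Lemma emb_inj i : injective (emb i).
Proof.
move=> x y /E_inj e; have : single i x i = single i y i by rewrite e.
by rewrite !single_id.
Qed.

Lemma emb_cvg i : emb i @ (1 : L) --> (1 : G).
Proof. exact: (cvg_comp _ _ (@single_cvg n L i) E_cvg). Qed.

Lemma near_emb i (A : set G) :
  (\forall g \near (1 : G), A g) -> \forall l \near (1 : L), A (emb i l).
Proof. by move=> nA; exact: emb_cvg nA. Qed.

Lemma emb_continuous i : continuous (emb i).
Proof. exact: morph_continuous (embM i) (@emb_cvg i). Qed.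

Lemma E_prod x : E x = \prod_(i < n) emb i (x i).
Proof. by rewrite {1}(prod_single x) (big_morph _ EM (morphg1 EM)). Qed.

Lemma commute_E g x : (forall j, commute g (emb j (x j))) -> commute g (E x).
Proof. by move=> gx; rewrite E_prod; apply: commute_prod => j _. Qed.

Lemma near_E (A : 'I_n -> set L) :
  (forall i, \forall l \near (1 : L), A i l) ->
  \forall g \near (1 : G), exists2 x, (forall i, A i (x i)) & E x = g.
Proof. by move=> nA; apply: E_open; exact: (near_box nA). Qed.

Lemma near_ET : \forall g \near (1 : G), exists x, E x = g.
Proof.
have nT (i : 'I_n) : \forall l \near (1 : L), True by exact: nearW.
by apply: filterS (near_E nT) => g [x _ <-]; exists x.
Qed.

(** ** The canonical factors *)

Definition germ_commute g i := \forall l \near (1 : L), commute g (emb i l).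

Lemma germ_centralizer_closed i : group_closed (mem [set g | germ_commute g i]).
Proof.
apply: group_closedP => [|x y].
  by apply: nearW => l; exact/commute_sym/commute1.
apply: filterS2 => l xl yl; apply/commute_sym/commuteM; first exact/commute_sym.
exact/commuteV/commute_sym.
Qed.

Definition germ_centralizer i := Subgroup (germ_centralizer_closed i).

(** The centralizer of such an element contains a neighbourhood of [1], so the
element is quasi-central. *)
Lemma germ_commute_eq1 g : (forall i, germ_commute g i) -> g = 1.
Proof.
move=> gE; suff : QZ G g by rewrite QZ1.
apply: QZ_near1; apply: filterS (near_E gE) => _ [x xP <-].
exact: commute_E.
Qed.

Lemma emb_commute i j x y : i != j -> commute (emb i x) (emb j y).
Proof.
move=> ij; apply: (morph_commute EM); apply: functional_extensionality_dep => k.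
rewrite /commute.
have -> : (single i x * single j y) k = single i x k * single j y k by [].
have -> : (single j y * single i x) k = single j y k * single i x k by [].
rewrite /single; case: eqP => [->|_]; last by rewrite mulg1 mul1g.
by rewrite (negPf ij) mulg1 mul1g.
Qed.

(** This is the centralizer of the product of the ranges of the other
embeddings, defined by commutation near [1] so that it visibly depends only on
germs. That all elements commute is part of [factor_commute]; see [factorE]. *)
Definition local_factor i : subgroup G :=
  Subgroup (bigcap_group_closed [set j | j != i] germ_centralizer).

Lemma emb_factor i l : emb i l ∈ local_factor i.
Proof.
by move=> j ji; apply: nearW => x; apply: emb_commute; rewrite eq_sym.
Qed.

Lemma factor_eq1 i g : g ∈ local_factor i -> germ_commute g i -> g = 1.
Proof.
move=> Pg gi; apply: germ_commute_eq1 => j.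
by have [->|/Pg] := eqVneq j i.
Qed.

(** A coordinate [x j] with [j] other than [i] commutes with the elements of
[L] close to [1], so [emb j (x j)] passes the germ test at every index. *)
Lemma factor_E i x : E x ∈ local_factor i -> E x = emb i (x i).
Proof.
move=> Px; congr E; apply: functional_extensionality_dep => j.
have [->|ji] := eqVneq j i; first by rewrite single_id.
rewrite single_neq //; apply: (@emb_inj j); rewrite emb1.
apply: (factor_eq1 (emb_factor (i:=j) (x j))).
have : germ_commute (E x) j by exact: Px.
apply: filterS => l.
rewrite /commute -!EM => /E_inj e.
rewrite -!singleM; congr (E (single j _)).
have : (x * single j l) j = (single j l * x) j by rewrite e.
have -> : (x * single j l) j = x j * single j l j by [].
have -> : (single j l * x) j = single j l j * x j by [].
by rewrite single_id.
Qed.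

(** Near [1] the factor is the range of [emb i], by [factor_E]; the set [A]
records that the coordinate is close to [1] as well, so that [emb i] is open as
a map to the factor. *)
Lemma near_factor i (A : set L) : (\forall l \near (1 : L), A l) ->
  \forall g \near (1 : G), g ∈ local_factor i -> exists2 l, A l & emb i l = g.
Proof.
move=> nA; have nA' : forall j, \forall l \near (1 : L), j = i -> A l.
  by move=> j; apply: filterS nA.
apply: filterS (near_E nA') => _ [x Ax <-] /factor_E ->.
by exists (x i) => //; exact: Ax.
Qed.

Lemma near_factorT i :
  \forall g \near (1 : G), g ∈ local_factor i -> exists l, emb i l = g.
Proof.
have nT : \forall l \near (1 : L), True by exact: nearW.
by apply: filterS (near_factor i nT) => g + Pg => /(_ Pg)[l _ <-]; exists l.
Qed.

Lemma near_factor_emb i (A : set G) :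
  (\forall l \near (1 : L), A (emb i l)) <->
  (\forall g \near (1 : G), g ∈ local_factor i -> A g).
Proof.
split=> [nA|nA].
  by apply: filterS (near_factor i nA) => g h /h[l Al <-].
by apply: filterS (near_emb i nA) => l; apply; exact: emb_factor.
Qed.

(** Let [u] belong to factor [k] and [v] to another factor. For small [e] in
the range of [emb k], the conjugate of [e] by [u^-1] is again a small element
of that range, so [v] commutes with it as well as with [e]; hence [[~ u, v]]
commutes with [e]. Exchanging the roles of [x] and [y] gives the germ test for
[[~ x, y]] at both indices, and at the other indices it is immediate. *)
Lemma factor_commute i j x y :
  i != j -> x ∈ local_factor i -> y ∈ local_factor j -> commute x y.
Proof.
move=> ij Px Py.
have germ_commg k m u v : k != m -> u ∈ local_factor k -> v ∈ local_factor m ->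
    [~ u, v] ∈ germ_centralizer k.
  move=> km Pu Pv; have vk : germ_commute v k by exact: Pv.
  (* u conjugates small elements of the range of emb k to small ones *)
  have := near_emb k (near1_conj u^-1 (near_factor k vk)).
  apply: filterS2 vk => l vl /(_ _)[|l' vl' l'l].
    by apply: subgroupJ (subgroupV Pu); exact: emb_factor.
  apply: commute_sym; rewrite /commute conjgC; congr (_ * _).
  rewrite commgEl [u ^ v]conjgE !conjgM -l'l.
  rewrite (conjg_commute (y := v^-1)); last exact/commuteV/commute_sym.
  by rewrite l'l conjgKV conjg_commute //; exact: commute_sym.
apply/commgP/eqP/germ_commute_eq1 => k.
have [->|ki] := eqVneq k i; first exact: (germ_commg i j).
have [->|kj] := eqVneq k j.
  suff : [~ x, y]^-1 ∈ germ_centralizer j.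
    by move/(@subgroupV _ (germ_centralizer j)); rewrite invgK.
  by rewrite invgR; apply: (germ_commg j i) => //; rewrite eq_sym.
have xk : x ∈ germ_centralizer k by exact: Px.
have yk : y ∈ germ_centralizer k by exact: Py.
rewrite commgEl; apply: (@subgroupM _ (germ_centralizer k)).
  exact: subgroupV.
exact: subgroupJ.
Qed.

Lemma factorE i g : g ∈ local_factor i <->
  forall j, j != i -> forall l, commute g (emb j l).
Proof.
split=> [Pg j ji l|cg j ji]; last by apply: nearW => l; exact: cg.
by apply: (factor_commute _ Pg (@emb_factor j l)); rewrite eq_sym.
Qed.

Lemma factor_is_closed i : closed (local_factor i).
Proof.
have -> : local_factor i =
    centralizer [set x | exists2 j, j != i & exists l, x = emb j l] :> set G.
  apply/seteqP; split=> [g Pg _ [j ji [l ->]]|g Cg].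
    exact: (factorE i g).1.
  by apply/factorE => j ji l; apply: Cg; exists j => //; exists l.
exact: closed_centralizer.
Qed.

Lemma factor_nondiscrete i :
  ~ \forall g \near (1 : G), g ∈ local_factor i -> g = 1.
Proof.
move=> /near_factor_emb n1; apply: L_nondiscrete.
by apply: filterS n1 => l; rewrite -(emb1 i) => /emb_inj.
Qed.

(** ** The dichotomy and the action of automorphisms *)

(** If the trace of [B] on [emb i] is trivial and [x] lies in [B] and in the
factor, then for small [e] in the range of [emb i] the commutator [[~ x, e]]
lies in [B], because [e] normalizes [B], and in that range, because it is
small; so it is trivial and [x] passes the germ test. *)
Lemma factor_dichotomy i (B : subgroup G) :
  closed B -> (\forall g \near (1 : G), normalizer B g) ->
  (\forall l \near (1 : L), emb i l ∈ B) \/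
  (forall x, x ∈ B -> x ∈ local_factor i -> x = 1).
Proof.
move=> cB nB; set V := preim_subgroup (embM i) (normalizer_subgroup B).
set N := preim_subgroup (embM i) B.
have oV : open V by apply: subgroup_open; exact: near_emb nB.
have cN : closed N by exact: (continuous_closedP _).1 (@emb_continuous i) _ cB.
have NJ y g : y ∈ N -> g ∈ V -> y ^ g ∈ N.
  by rewrite /= (morphgJ (embM i)) => Ny Vg; exact: normalizerJ.
have [N1|] := just_infinite_dichotomy L_hji oV cN NJ; last by left.
right=> x Bx Px; apply: (factor_eq1 Px).
have nN l : emb i l ∈ B -> emb i l = 1.
  move=> Bl; rewrite (N1 l) ?emb1 //.
  by apply: mem_normalizer => y By; apply: subgroupJ => //; exact: subgroupV.
have nP := near_emb i (near1_commg x (near_factorT i)).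
apply: filterS2 (near_emb i nB) nP => l nl /(_ _)[|l' l'l].
  apply: subgroupM; first exact: subgroupV.
  by apply: subgroupJ => //; exact: emb_factor.
apply/commgP/eqP; rewrite commgEl -l'l; apply: nN.
by rewrite l'l; apply: subgroupM; [exact: subgroupV | exact: normalizerJ].
Qed.

Lemma emb_conj_E i l x : emb i l ^ E x = emb i (l ^ x i).
Proof.
rewrite /emb -(morphgJ EM); congr E; apply: functional_extensionality_dep => j.
have -> : (single i l ^ x) j = single i l j ^ x j by [].
by rewrite /single; case: eqP => [->|] // _; exact: conj1g.
Qed.

Definition range_emb i := im_subgroup (embM i) (subgroupT L).

(** Carrying the inverse along keeps the hypotheses symmetric, so that each
lemma applies to [f] and to its inverse. *)
Definition inverse_automorphisms (f g : G -> G) :=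
  [/\ {morph f : x y / x * y}, {morph g : x y / x * y},
      continuous f /\ continuous g, cancel f g & cancel g f].

Lemma inverse_automorphisms_sym f g :
  inverse_automorphisms f g -> inverse_automorphisms g f.
Proof. by case=> fM gM [fc gc] fK gK. Qed.

(** One half of the statement that [f] carries the germ of the range of [emb i]
to that of [emb j]; the other half is the same relation for the inverse of
[f]. *)
Definition overlaps (f : G -> G) i j :=
  \forall l \near (1 : L), exists l', f (emb i l') = emb j l.

Lemma near1_morph (f : G -> G) (A : set G) :
  {morph f : x y / x * y} -> continuous f ->
  (\forall g \near (1 : G), A g) -> \forall g \near (1 : G), A (f g).
Proof.
move=> fM fc nA; have nA' : nbhs (f 1) A by rewrite (morphg1 fM).
exact: fc _ _ nA'.
Qed.

(** The range of [emb i] is compact and normalized by the range of [E], which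
is open; so its image by [f] is closed and has an open normalizer. *)
Lemma image_dichotomy f g i j : inverse_automorphisms f g ->
  overlaps f i j \/ forall l, f (emb i l) ∈ local_factor j -> l = 1.
Proof.
move=> [fM gM [fc gc] fK gK].
set B := im_subgroup fM (range_emb i).
have cB : closed B.
  apply: compact_closed => //.
  have -> : subgroup_set B = [set f (emb i l) | l in [set: L]].
    apply/seteqP; split=> [_ [_ [l _ <-] <-]|_ [l _ <-]]; first by exists l.
    by exists (emb i l) => //; exists l.
  apply: continuous_compact; last by case: L_hji => -[].
  apply: continuous_subspaceT => l.
  by apply: continuous_comp; [exact: emb_continuous | exact: fc].
have nB : \forall h \near (1 : G), normalizer B h.
  have := near1_morph gM gc near_ET.
  apply: filterS => h [x Ex].
  have BJ y b : b ∈ B -> b ^ f (E y) ∈ B.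
    move=> [_ [l _ <-] <-]; exists (emb i (l ^ y i)); first by exists (l ^ y i).
    by rewrite -emb_conj_E (morphgJ fM).
  have -> : h = f (E x) by rewrite Ex gK.
  apply: mem_normalizer => b; first exact: BJ.
  by rewrite -(morphgV fM) -(morphgV EM); exact: BJ.
have [ov|B1] := factor_dichotomy j cB nB; [left|right].
  by apply: filterS ov => l [_ [l' _ <-] fl]; exists l'.
move=> l Pl; apply: (@emb_inj i); apply: (can_inj fK).
rewrite emb1 (morphg1 fM); apply: B1 => //.
by exists (emb i l) => //; exists l.
Qed.

(** If [f] maps the range of [emb i] to a subgroup that meets every factor
trivially, then a small element of this image and a small element of the range
of [emb j] have a commutator that lies in the image and in the factor [j], so
they commute; by the germ test the image is discrete, which is absurd. Once
there is an overlap for [f], the dichotomy for the inverse gives the converse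
overlap, since the two groups then have a nondiscrete intersection. *)
Lemma exists_overlap f g i : inverse_automorphisms f g ->
  exists j, overlaps f i j /\ overlaps g j i.
Proof.
move=> fg; have [fM gM [fc gc] fK gK] := fg.
have [j ov] : exists j, overlaps f i j.
  apply: contrapT => /forallNP nov.
  have trivial j l : f (emb i l) ∈ local_factor j -> l = 1.
    by move: l; case: (image_dichotomy i j fg) => // /nov.
  apply: L_nondiscrete.
  have := near_emb i (near1_morph fM fc near_ET).
  apply: filterS => l [x Ex].
  suff : f (emb i l) = 1.
    rewrite -(morphg1 fM) => /(can_inj fK); rewrite -(emb1 i); exact: emb_inj.
  apply: germ_commute_eq1 => j.
  have := near_emb j (near1_morph gM gc near_ET).
  apply: filterS => m [y Ey].
  have em : emb j m = f (E y) by rewrite Ey gK.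
  (* E y acts on the range of emb i as y i, so the commutator is in the image *)
  set c := [~ l, y i].
  have fcE : f (emb i c) = [~ f (emb i l), emb j m].
    rewrite !commgEl embM morphgV; last exact: embM.
    by rewrite fM (morphgV fM) -emb_conj_E (morphgJ fM) -em.
  apply/commgP/eqP; rewrite -fcE.
  rewrite (trivial j c) ?emb1 ?(morphg1 fM) // fcE commgEr -Ex.
  rewrite (_ : (emb j m)^-1 = emb j m^-1); last by rewrite (morphgV (embM j)).
  by rewrite emb_conj_E -embM; exact: emb_factor.
exists j; split=> //.
have [//|triv] := image_dichotomy j i (inverse_automorphisms_sym fg).
case: L_nondiscrete; apply: filterS ov => l [l' fl'].
by apply: triv; rewrite -fl' fK; exact: emb_factor.
Qed.

Lemma germ_commute_aut f g j k x : inverse_automorphisms f g ->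
  overlaps f j k -> germ_commute x j -> germ_commute (f x) k.
Proof.
move=> [fM gM [fc gc] fK gK] ov xj.
have := near_emb k (near1_morph gM gc (near_factor j xj)).
apply: filterS2 ov => l [l' fl'] /(_ _)[|l'' xl'' e].
  by rewrite -fl' fK; exact: emb_factor.
by rewrite -(gK (emb k l)) -e; exact: morph_commute fM xl''.
Qed.

(** Two factors with the same target would overlap in a nondiscrete group,
although they commute; so the choice of an overlapping index is injective,
hence a permutation. The factors are defined by commutation with germs, and [f]
permutes these germs. *)
Lemma factor_aut f g : inverse_automorphisms f g ->
  exists s : {perm 'I_n}, forall i, f @` local_factor i = local_factor (s i).
Proof.
move=> fg; have [fM gM [fc gc] fK gK] := fg.
have [s sP] := choice (fun i => exists_overlap i fg).
have s_inj : injective s.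
  move=> i j sij; apply: contrapT => /eqP ij; apply: L_nondiscrete.
  have [oi _] := sP i; have [oj _] := sP j; rewrite -sij in oj.
  apply: filterS2 oi oj => l [x fx] [y fy].
  have /(can_inj fK) exy : f (emb i x) = f (emb j y) by rewrite fx fy.
  apply: (@emb_inj (s i)); rewrite -fx emb1 -(morphg1 fM); congr f.
  apply: (factor_eq1 (emb_factor x)); rewrite exy; apply: nearW => z.
  exact/emb_commute/eqP/nesym/eqP.
exists (perm s_inj) => i; rewrite permE; apply/seteqP.
split=> [_ [x Px <-] k ksi|y Py].
  have [s' ss' s's] := injF_bij s_inj; rewrite -(s's k).
  apply: (germ_commute_aut fg (sP _).1); apply: Px.
  by apply: contraNneq ksi => <-; rewrite s's.
exists (g y) => [j ji|]; last exact: gK.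
apply: (germ_commute_aut (inverse_automorphisms_sym fg) (sP _).2); apply: Py.
by apply: contraNneq ji => /s_inj ->.
Qed.

Lemma conj_inverse_automorphisms g :
  inverse_automorphisms (fun x => x ^ g) (fun x => x ^ g^-1).
Proof.
have cJ (h : G) : continuous (fun x => x ^ h).
  move=> x; apply: cvgMg; first exact: cvg_cst.
  by apply: cvgMg; [exact: cvg_id | exact: cvg_cst].
split=> //; [by move=> x y; exact: conjMg | by move=> x y; exact: conjMg | |].
  exact: conjgK.
exact: conjgKV.
Qed.

Lemma factor_conj i g :
  exists j, forall x, x ∈ local_factor i <-> x ^ g ∈ local_factor j.
Proof.
have [s sP] := factor_aut (conj_inverse_automorphisms g).
exists (s i) => x; split=> [Px|]; first by rewrite -sP; exists x.
by rewrite -sP => -[y Py /conjg_inj <-].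
Qed.

(** ** The three types of factors *)

Lemma near_factor_mul i (A : set L) : (\forall l \near (1 : L), A l) ->
  \forall g \near (1 : G), exists l c,
    [/\ A l, centralizer (local_factor i) c & g = emb i l * c].
Proof.
move=> nA; have nA' : forall j, \forall l \near (1 : L), j = i -> A l.
  by move=> j; apply: filterS nA.
apply: filterS (near_E nA') => _ [x Ax <-].
exists (x i), (E ((single i (x i))^-1 * x)); split; first exact: Ax.
  move=> y Py; apply/commute_sym/commute_E => j.
  have [->|ji] := eqVneq j i; last exact: (factorE i y).1.
  have -> : ((single i (x i))^-1 * x) i = (single i (x i) i)^-1 * x i by [].
  by rewrite single_id mulVg emb1; exact: commute1.
by rewrite -EM mulVKg.
Qed.

Lemma factor_centerless i x :
  x ∈ local_factor i -> centralizer (local_factor i) x -> x = 1.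
Proof.
move=> Px Cx; apply: (factor_eq1 Px); apply: nearW => l.
by apply: Cx; exact: emb_factor.
Qed.

Lemma near_mul_centralizer i (A : subgroup G) (AP : A `<=` local_factor i) :
  (\forall l \near (1 : L), emb i l ∈ A) ->
  \forall g \near (1 : G), g ∈ mul_centralizer AP.
Proof.
move=> nA; apply: filterS (near_factor_mul i nA) => _ [l [c [Al Cc ->]]].
by exists (emb i l) => //; exists c.
Qed.

Lemma mul_centralizer_factor i (A : subgroup G) (AP : A `<=` local_factor i) x :
  x ∈ mul_centralizer AP -> x ∈ local_factor i -> x ∈ A.
Proof.
move=> [a Aa [c Cc <-]] Pac; have Pc : c ∈ local_factor i.
  by rewrite -(mulKg a c); apply: subgroupM => //; exact/subgroupV/AP.
by rewrite (factor_centerless Pc Cc) mulg1.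
Qed.

Lemma centralizer_factor_conj i j g c :
  (forall x, x ∈ local_factor i <-> x ^ g ∈ local_factor j) ->
  centralizer (local_factor i) c -> centralizer (local_factor j) (c ^ g).
Proof.
move=> ij Cc y; rewrite -[y](conjgKV g) => /ij Py.
exact/commuteJ/Cc.
Qed.

Let R : subgroup G := Res G.
Let S : subgroup G := sub_extension (Res R).

Lemma Res_is_normal : normal_subgroup R.
Proof. by apply/normal_subgroupP => x g; exact: Res_normal. Qed.

Lemma Res2_normal x g : x ∈ S -> x ^ g ∈ S.
Proof. exact: image_Res_normal Res_is_normal. Qed.

Lemma Res2_sub x : x ∈ S -> x ∈ R.
Proof. by move=> /image_ResP[]. Qed.

Lemma subI_factor i (A : subgroup G) :
  subgroupI (local_factor i) A `<=` local_factor i.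
Proof. by move=> x []. Qed.

Let X i := mul_centralizer (@subI_factor i S).

(** The indices [j] such that [S] contains a neighbourhood of [1] in the factor
[j] are permuted by conjugation, because [S] is normal in [G]. The intersection
of the subgroups [X j] over these indices is therefore normal in [G]; it is
open, being a finite intersection of open subgroups. *)
Lemma Res_sub_mul_centralizer i :
  (\forall l \near (1 : L), emb i l ∈ S) -> R `<=` X i.
Proof.
move=> Si; set D := [set j | \forall l \near (1 : L), emb j l ∈ S].
set Y := Subgroup (bigcap_group_closed D X).
move=> x /Res_subP/(_ Y); apply => // {x}.
  apply: near_forall_fin => j.
  have [Dj|nDj] := pselect (D j); last by apply: nearW => g /nDj.
  have nX : \forall g \near (1 : G), g ∈ X j.
    apply: near_mul_centralizer; apply: filterS Dj => l Sl.
    by split=> //; exact: emb_factor.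
  by apply: filterS nX.
move=> y g Yy j Dj.
have [k jk] := factor_conj j g^-1.
have kj x : x ∈ local_factor k <-> x ^ g ∈ local_factor j.
  by rewrite -[in X in X <-> _](conjgK g x) -jk.
(* the set D of indices is stable under the action of g^-1 *)
have Dk : D k.
  apply/near_factor_emb; move/near_factor_emb: Dj => /(near1_conj g).
  apply: filterS => h Sh /kj /Sh Shg.
  by rewrite -(conjgK g h); exact: Res2_normal.
have [a [Pa Sa] [c Cc <-]] := Yy k Dk.
exists (a ^ g); first by split; [exact/kj | exact: Res2_normal].
exists (c ^ g); last by rewrite conjMg.
exact: centralizer_factor_conj kj Cc.
Qed.

Let T i := subgroupI (local_factor i) R.

Lemma trace_closed i : closed (T i).
Proof. by apply: closedI; [exact: factor_is_closed | exact: Res_closed]. Qed.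

Lemma trace_sub_Res2 i : (\forall l \near (1 : L), emb i l ∈ S) -> T i `<=` S.
Proof.
move=> /Res_sub_mul_centralizer RX x [Px /RX Xx].
by have [] := mul_centralizer_factor Xx Px.
Qed.

Lemma subgroup_eq1 (B : subgroup G) :
  (forall x, x ∈ B -> x = 1) -> B = [set 1] :> set G.
Proof.
by move=> B1; apply/seteqP; split=> // _ ->; exact: subgroup1.
Qed.

(** [O] is normalized by the trace [T i] and by the centralizer of the factor,
which together contain a neighbourhood of [1]; so the dichotomy applies to [O].
When [O] is nontrivial, [R] normalizes the open subgroup [O C(P_i)] because [R]
lies in [T i] times the centralizer, and so [Res(R)] lies in [O C(P_i)]. *)
Lemma trace_simple i : (\forall l \near (1 : L), emb i l ∈ S) ->
  forall O : subgroup G, O `<=` T i -> closed O ->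
    (forall y g, y ∈ O -> g ∈ T i -> y ^ g ∈ O) ->
  O = [set 1] :> set G \/ O = T i :> set G.
Proof.
move=> Si O OT cO OJ; have OP : O `<=` local_factor i by move=> x /OT[].
have nO : \forall g \near (1 : G), normalizer O g.
  apply: filterS (near_factor_mul i Si) => _ [l [c [Sl Cc ->]]].
  have Tl : emb i l ∈ T i by split; [exact: emb_factor | exact: Res2_sub].
  apply: (@subgroupM _ (normalizer_subgroup O)).
    by apply: mem_normalizer => y Oy; apply: OJ => //; exact: subgroupV.
  apply: mem_normalizer => y Oy; rewrite conjg_commute //.
    exact/commute_sym/Cc/OP.
  exact/commuteV/commute_sym/Cc/OP.
have [Oi|O1] := factor_dichotomy i cO nO; last first.
  by left; apply: subgroup_eq1 => x Ox; apply: O1 => //; exact: OP.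
right; apply/seteqP; split=> // x Tx; have [Px Rx] := Tx.
suff SO : S `<=` mul_centralizer OP.
  exact: mul_centralizer_factor (SO _ (trace_sub_Res2 Si Tx)) Px.
move=> y /image_ResP[Ry] /(_ (subgroupI R (mul_centralizer OP)))[] //.
- by move=> z [].
- by apply: filterS (near_mul_centralizer OP Oi) => g Zg Rg; split.
move=> z g [Rz Wz] Rg; split; first exact: Res_normal.
have [o Oo [c Cc <-]] := Wz.
(* g = s * d, where s normalizes both parts and d centralizes O *)
have [s [Ps Ss] [d Cd <-]] := Res_sub_mul_centralizer Si Rg.
have Ts : s ∈ T i by split=> //; exact: Res2_sub.
exists (o ^ s); first exact: OJ.
exists (c ^ (s * d)); last first.
  rewrite conjMg [in o ^ (s * d)]conjgM (conjg_commute (y := d)) //.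
  by apply/commute_sym/Cd/OP; exact: OJ.
apply: centralizerJ Cc => p Pp; rewrite invgM conjgM.
have -> : p ^ d^-1 = p by apply: conjg_commute; exact/commuteV/commute_sym/Cd.
by apply: subgroupJ => //; exact: subgroupV.
Qed.

Lemma open_in_R i :
  open_in (local_factor i) R <-> \forall l \near (1 : L), emb i l ∈ R.
Proof. by split=> [/open_inP/near_factor_emb//|/near_factor_emb/open_inP]. Qed.

(** A relatively open normal subgroup of the factor meets [T i] in a nontrivial
closed normal subgroup, which is all of [T i] by simplicity. The other
inclusion is general: open normal subgroups of [G] induce such subgroups on the
factor. *)
Lemma Res_factor i : (\forall l \near (1 : L), emb i l ∈ S) ->
  local_factor i `&` R = set_val @` Res (local_factor i).
Proof.
move=> Si; apply/seteqP; split=> [x Tx|x /image_ResP[Px Rx]].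
  apply/image_ResP; split=> [|N NP nN NJ]; first by case: Tx.
  have [||y g [Ny Ty] Tg|e|e] := @trace_simple i Si (subgroupI N (T i)).
  - by move=> y [].
  - apply: closedI; last exact: trace_closed.
    exact: relatively_open_closed (@factor_is_closed i) NP nN.
  - split; last exact: subgroupJ.
    by apply: NJ => //; case: Tg.
  - case: (@factor_nondiscrete i); move/near_factor_emb: Si => nS.
    apply: filterS2 nN nS => g Ng Sg Pg.
    suff : g ∈ subgroupI N (T i) by rewrite e.
    by split; [exact: Ng | split=> //; exact/Res2_sub/Sg].
  by have : x ∈ T i by []; rewrite -e => -[].
split=> //; apply/Res_subP => N nN NJ.
suff [] : x ∈ subgroupI (local_factor i) N by [].
apply: Rx; first by move=> y [].
  by apply: filterS nN => g Ng Pg; split.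
move=> y g [Py Ny] Pg; split; [exact: subgroupJ | exact: NJ].
Qed.

(** A relatively open normal subgroup of [R] meets the nondiscrete group [T i]
nontrivially, hence contains it. *)
Lemma simple_trace_sub_Res2 i : (\forall l \near (1 : L), emb i l ∈ R) ->
  topologically_simple (T i) -> T i `<=` S.
Proof.
move=> Ri /(topologically_simpleP (@trace_closed i))[_ simpleT] x Tx.
apply/image_ResP; split=> [|N NR nN NJ]; first by case: Tx.
have [||y g [Ny Ty] Tg|e|e] := simpleT (subgroupI N (T i)).
- by move=> y [].
- apply: closedI; last exact: trace_closed.
  by apply: relatively_open_closed NR nN; exact: Res_closed.
- split; last exact: subgroupJ.
  by apply: NJ => //; case: Tg.
- case: (@factor_nondiscrete i); move/near_factor_emb: Ri => nR.
  apply: filterS2 nN nR => g Ng Rg Pg.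
  suff : g ∈ subgroupI N (T i) by rewrite e.
  by split; [exact/Ng/Rg | split=> //; exact: Rg].
by have := Tx; rewrite -e => -[].
Qed.

Lemma factor_trichotomy i :
  exactly_one3 (reducible_type (local_factor i))
    (mysterious_type (local_factor i)) (simple_type (local_factor i)).
Proof.
have normal_dich (B : subgroup G) : closed B ->
    (forall x g, x ∈ B -> x ^ g ∈ B) ->
    (\forall l \near (1 : L), emb i l ∈ B) \/ local_factor i `&` B = [set 1].
  move=> cB BJ; have nB : \forall g \near (1 : G), normalizer B g.
    by apply: nearW => g; apply: mem_normalizer => x; exact: BJ.
  have [|B1] := factor_dichotomy i cB nB; [by left|right].
  apply: (subgroup_eq1 (B := subgroupI (local_factor i) B)) => x [Px Bx].
  exact: B1.
have open_ntriv (B : subgroup G) : (\forall l \near (1 : L), emb i l ∈ B) ->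
    local_factor i `&` B <> [set 1].
  move=> /near_factor_emb nB e; apply: (@factor_nondiscrete i).
  apply: filterS nB => g Bg Pg; suff : (local_factor i `&` B) g by rewrite e.
  by split=> //; exact: Bg.
have [Ri|R1] := normal_dich R (@Res_closed G) (@Res_normal G); last first.
  apply: Or31; split=> //; first by case=> /open_in_R /open_ntriv.
  by case=> _ /open_in_R /open_ntriv.
have nred : ~ reducible_type (local_factor i) by exact: open_ntriv R Ri.
have [Si|S1] := normal_dich S (image_Res_closed (@Res_closed G)) Res2_normal.
  apply: Or33; split=> //; first by case=> _; exact: open_ntriv S Si.
  split; [exact: Res_factor | exact/open_in_R |].
  apply/(topologically_simpleP (@trace_closed i)).
  split; first exact: open_ntriv R Ri.
  exact: trace_simple.
apply: Or32; split=> //; first by split=> //; exact/open_in_R.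
case=> _ _ /(simple_trace_sub_Res2 Ri) TS.
apply: (open_ntriv _ Ri); apply: (subgroup_eq1 (B := T i)) => x Tx.
have : (local_factor i `&` S) x by split; [case: Tx | exact: TS].
by rewrite S1.
Qed.

(** ** The product of the factors *)

Local Notation PP := (prod_topology (fun i => local_factor i)).

Definition prod_factors (x : PP) : G := \prod_(i < n) set_val (x i).

Lemma prod_factorsM : {morph prod_factors : x y / x * y}.
Proof.
move=> x y; rewrite /prod_factors -prodgM_uniq //; first exact: index_enum_uniq.
move=> i j ij; exact: factor_commute ij (set_val_mem _) (set_val_mem _).
Qed.

(** The part of the product outside [i] centralizes the factor [i], so the
coordinate [i] can be recovered up to the centralizer. *)
Lemma prod_factors_coord i (x : PP) :
  exists2 c, centralizer (local_factor i) c &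
    prod_factors x = set_val (x i) * c.
Proof.
pose u : PP := fun j => if j == i then x j else 1.
pose v : PP := fun j => if j == i then 1 else x j.
have -> : x = u * v.
  apply: functional_extensionality_dep => j.
  have -> : (u * v) j = u j * v j by [].
  by rewrite /u /v; case: eqP => _; rewrite ?mulg1 ?mul1g.
exists (prod_factors v).
  move=> y Py; apply/commute_sym/commute_prod => j _; rewrite /v.
  have [_|ji] := eqVneq j i; first exact: commute1.
  by apply: (factor_commute _ Py (set_val_mem (x j))); rewrite eq_sym.
rewrite prod_factorsM; congr (_ * _).
have -> : (u * v) i = u i * v i by [].
rewrite /u /v eqxx mulg1 /prod_factors.
rewrite (eq_bigr (fun j => if j == i then set_val (x j) : G else 1)).
  by rewrite -big_mkcond big_pred1_eq.
by move=> j _; case: eqP.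
Qed.

Lemma prod_factors_inj : injective prod_factors.
Proof.
have inj1 x : prod_factors x = 1 -> x = 1.
  move=> x1; apply: functional_extensionality_dep => i.
  have [c Cc xc] := prod_factors_coord i x.
  apply: set_val_inj; apply: (factor_centerless (set_val_mem (x i))).
  rewrite (_ : set_val (x i) = c^-1).
    exact: (@subgroupV _ (centralizer_subgroup (local_factor i))).
  by apply: (mulIg c); rewrite mulVg -xc.
move=> x y xy; apply/divg1_eq/inj1.
by rewrite prod_factorsM (morphgV prod_factorsM) xy mulgV.
Qed.

Definition factor_product : subgroup G :=
  im_subgroup prod_factorsM (subgroupT PP).

Lemma prod_factors_cvg : prod_factors @ (1 : PP) --> (1 : G).
Proof.
apply: (cvg_prodg (FF := nbhs_filter (1 : PP))) => i.
apply: (cvg_comp _ _ (@near_coord _ (fun i => local_factor i) (1 : PP) i)).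
exact: (@set_val_continuous G (local_factor i) 1).
Qed.

Definition factor_emb i l : local_factor i :=
  SigSub (mem_set (@emb_factor i l)).

Lemma factor_embM i : {morph factor_emb i : x y / x * y}.
Proof. by move=> x y; apply: set_val_inj; exact: embM. Qed.

Lemma factor_emb_continuous i : continuous (factor_emb i).
Proof. by apply: continuous_comp_initial; exact: emb_continuous. Qed.

Lemma factor_emb_cvg i : factor_emb i @ (1 : L) --> (1 : local_factor i).
Proof.
have c := @factor_emb_continuous i 1.
by rewrite /continuous_at (morphg1 (@factor_embM i)) in c.
Qed.

(** Near [1] the product of the factors agrees with the power of [L], on which
[E] is open. *)
Lemma prod_factors_open (A : set PP) : (\forall x \near (1 : PP), A x) ->
  \forall g \near (1 : G), exists2 x, A x & prod_factors x = g.
Proof.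
move=> nA; pose eta (x : Ln) : PP := fun i => factor_emb i (x i).
have eta1 : eta @ (1 : Ln) --> (1 : PP).
  apply: (prod_cvg (FF := nbhs_filter (1 : Ln))) => i.
  apply: (cvg_comp _ _ (@near_coord _ (fun _ : 'I_n => L) (1 : Ln) i)).
  exact: factor_emb_cvg.
have := E_open (eta1 _ nA); apply: filterS => _ [x Ax <-].
by exists (eta x); [exact: Ax | rewrite E_prod].
Qed.

Lemma factor_product_open : open factor_product.
Proof.
apply: subgroup_open.
have nT : \forall x \near (1 : PP), True.
  by apply: filterS (@filterT _ _ (nbhs_filter (1 : PP))).
by apply: filterS (prod_factors_open nT) => g [x _ <-]; exists x.
Qed.

Lemma factor_product_direct :
  internal_direct_product local_factor factor_product.
Proof.
have Qx x : prod_factors x ∈ factor_product by exists x.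
pose f (x : PP) : factor_product := SigSub (mem_set (Qx x)).
have fM : {morph f : x y / x * y}.
  by move=> x y; apply: set_val_inj; exact: prod_factorsM.
exists f; split=> //; apply: open_bijection_isomorphism => //.
- by move=> x y /(congr1 set_val) /prod_factors_inj.
- move=> q; have [x _ xq] := set_val_mem q; exists x; exact: set_val_inj.
- apply: (cvg_subgroup (FF := nbhs_filter (1 : PP))); exact: prod_factors_cvg.
- move=> A nA; apply/near1_subgroup; apply: filterS (prod_factors_open nA).
  by move=> g [x Ax xg] q qg; exists x => //; apply: set_val_inj; rewrite qg.
Qed.

(** An element of the factor that commutes with small elements of the factor
commutes with small elements of every [emb j], so it passes the germ test. *)
Lemma QZ_factor i : QZ (local_factor i) = [set 1].
Proof.
apply/seteqP; split=> [x /near1_QZ/near1_subgroup nx|_ ->]; last first.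
  apply/QZ_near1/near1_subgroup; apply: nearW => g y _.
  exact/commute_sym/commute1.
apply/set_val_inj/(factor_eq1 (set_val_mem x)); apply/near_factor_emb.
apply: filterS nx => g xg /mem_set_val[h hg].
rewrite -hg; apply: (morph_commute (@set_valM G (local_factor i))).
exact: xg.
Qed.

Lemma factor_locally_iso i : exists K : subgroup (local_factor i),
  [/\ compact K, open K & isomorphic K L].
Proof.
have KM : {morph factor_emb i : x y / x * y} by exact: factor_embM.
pose K := im_subgroup KM (subgroupT L); exists K; split.
- have -> : subgroup_set K = factor_emb i @` [set: L] by [].
  apply: continuous_compact; last by case: L_hji => -[].
  exact/continuous_subspaceT/factor_emb_continuous.
- apply: subgroup_open; apply/near1_subgroup; apply: filterS (near_factorT i).
  move=> g Pg h hg; have [|l lg] := Pg.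
    by rewrite -hg; exact: set_val_mem.
  by exists l => //; apply: set_val_inj; rewrite hg.
apply: isomorphic_sym.
have Kl l : factor_emb i l ∈ K by exists l.
pose f l : K := SigSub (mem_set (Kl l)).
have fM : {morph f : x y / x * y}.
  by move=> x y; apply: set_val_inj; exact: factor_embM.
exists f; apply: open_bijection_isomorphism => //.
- by move=> x y /(congr1 set_val) /(congr1 set_val) /emb_inj.
- move=> k; have [l _ lk] := set_val_mem k; exists l; exact: set_val_inj.
- by apply: cvg_subgroup; exact: factor_emb_cvg.
- move=> A nA; apply/near1_subgroup/near1_subgroup.
  apply: filterS (near_factor i nA) => g Pg h hg k kh.
  have [|l Al lg] := Pg; first by rewrite -hg; exact: set_val_mem.
  exists l => //; do 2!apply: set_val_inj.
  by rewrite kh hg.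
Qed.

(** The product is generated by the factors, which an automorphism permutes. *)
Lemma factor_product_characteristic : characteristic factor_product.
Proof.
have sub f g : inverse_automorphisms f g ->
    forall x, x ∈ factor_product -> f x ∈ factor_product.
  move=> fg; have [fM _ _ _ _] := fg; have [s sP] := factor_aut fg.
  have PQ i y : y ∈ local_factor i -> y ∈ factor_product.
    move=> Py; pose u : PP := fun j => if j == i then insubd 1 y else 1.
    exists u => //; rewrite /prod_factors.
    rewrite (eq_bigr (fun j => if j == i then y else 1)).
      by rewrite -big_mkcond big_pred1_eq.
    by rewrite /u => j _; case: eqP => // ->; apply: insubdK; exact: mem_set.
  move=> _ [x _ <-]; rewrite /prod_factors (big_morph f fM (morphg1 fM)).
  apply: big_ind => [||i _]; [exact: subgroup1 | exact: subgroupM |].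
  apply: (PQ (s i)); rewrite -sP; exists (set_val (x i)) => //.
  exact: set_val_mem.
move=> f [fM fc [g [fK gK gc]]].
have fg : inverse_automorphisms f g by split=> //; exact: inverse_morph fK gK.
apply/seteqP; split=> [_ [x Qx <-]|x Qx]; first exact: sub fg _ Qx.
by exists (g x); [exact: sub (inverse_automorphisms_sym fg) _ Qx | exact: gK].
Qed.

End LocalProduct.

(** * Groups of type (JH) with trivial quasi-centre *)

Lemma discrete_of_near1 (G : topGroupType) :
  (\forall g \near (1 : G), g = 1) -> discrete_subset [set: G].
Proof.
move=> n1 x _; split; first by rewrite inE.
exists [set x]; last by rewrite setIT.
apply: filterS (near_translate x n1) => y /= xy1.
by rewrite -[y](mulVKg x) xy1 mulg1.
Qed.

Theorem theorem4p8 (n : nat) (G : topGroupType) (G_tdlc : tdlc G)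
    (G_JH : type_JH n G) (QZ1 : QZ G = [set 1]) :
  exists (J : topGroupType) (Q : subgroup G) (P : 'I_n -> subgroup G),
    [/\ hereditarily_just_infinite J,
        [/\ open Q, forall i, closed (P i) & internal_direct_product P Q],
        (forall f : G -> G, topgroup_isomorphism f ->
           exists s : {perm 'I_n}, forall i, f @` P i = P (s i)) /\
        characteristic Q,
        forall i, QZ (P i) = [set 1] /\
          exists K : subgroup (P i), [/\ compact K, open K & isomorphic K J]
      & forall i, exactly_one3 (reducible_type (P i)) (mysterious_type (P i))
                    (simple_type (P i))].
Proof.
have [[_ hausG _] nd _ _ [L [U [hL oU UL]]]] := G_JH.
have [phi [phiM phi_c [psi [phiK psiK psi_c]]]] := UL.
pose Ln := prod_topology (fun _ : 'I_n => L).
have psiM : {morph psi : x y / x * y} by exact: inverse_morph phiM phiK psiK.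
pose E (x : Ln) : G := set_val (psi x).
have EM : {morph E : x y / x * y} by move=> x y; rewrite /E psiM.
have E_inj : injective E by move=> x y /set_val_inj /(can_inj psiK).
have E1 : E @ (1 : Ln) --> (1 : G).
  rewrite -(morphg1 EM).
  apply: (cvg_comp _ _ (psi_c 1)); exact: set_val_continuous.
have E_open (A : set Ln) : (\forall x \near (1 : Ln), A x) ->
    \forall g \near (1 : G), exists2 x, A x & E x = g.
  move=> nA; have nA' : nbhs (phi 1) A by rewrite (morphg1 phiM).
  have /near1_subgroup nU := phi_c _ _ nA'.
  apply: filterS2 nU (near1_mem oU) => g Ag /mem_set_val[u ug].
  by exists (phi u); [exact: Ag | rewrite /E phiK].
have ndL : ~ \forall l \near (1 : L), l = 1.
  move=> nL; apply: nd; apply: discrete_of_near1.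
  have := E_open _ (near_box (fun _ : 'I_n => nL)).
  apply: filterS => _ [x x1 <-].
  have -> : x = 1 by exact: functional_extensionality_dep.
  exact: morphg1 EM.
exists L, (factor_product EM E_inj E1 E_open QZ1), (local_factor E); split=> //.
- split.
  + exact: factor_product_open.
  + by move=> i; exact: factor_is_closed.
  + exact: factor_product_direct.
- split; last exact: factor_product_characteristic.
  move=> f [fM fc [g [fK gK gc]]].
  have fg : inverse_automorphisms f g.
    by split=> //; exact: inverse_morph fK gK.
  exact: (factor_aut EM E_inj E1 E_open hausG QZ1 hL ndL fg).
- by move=> i; split; [exact: QZ_factor | exact: factor_locally_iso].
- by move=> i; exact: factor_trichotomy.
Qed.
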